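(* Let $k$ be a positive integer and let $H$ be a fixed (finite) $k$-uniform hypergraph whose vertex set is the disjoint union of $k+1$ subsets such that every edge of $H$ contains at most one vertex in each of these subsets. Then the Turán density $\pi(H(r))$ tends to $0$ as $r$ tends to infinity.
   Context: For a $k$-uniform hypergraph $H=(V,E)$ and an integer $r\ge k$, the $r$-augmentation $H(r)$ of $H$ is the $r$-uniform hypergraph with vertex set $V\cup S$ and edge set $\{e\cup S: e\in E\}$, where $S$ is a set with $S\cap V=\emptyset$ and $|S|=r-k$. For a fixed $r$-uniform hypergraph $F$, $ex(n,F)$ denotes the maximum possible number of edges in an $r$-uniform hypergraph on $n$ vertices that contains no copy of $F$ (as a not necessarily induced subhypergraph), and the Turán density of $F$ is $\pi(F)=\lim_{n\to\infty} ex(n,F)/\binom{n}{r}$ (this limit always exists). *)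

(* Defs.v *)
From mathcomp Require Import all_boot all_order all_algebra.
From mathcomp Require Import all_classical all_reals all_analysis.

Set Implicit Arguments.
Unset Strict Implicit.
Unset Printing Implicit Defensive.

Import Order.TTheory GRing.Theory Num.Theory.
Import numFieldNormedType.Exports.

(* A hypergraph is a finite type of vertices V together with its edge set,
   a value of type {set {set V}}. *)

Definition uniform (V : finType) (k : nat) (E : {set {set V}}) : bool :=
  [forall e in E, #|e| == k].

(* The parts P i are allowed to be empty. *)
Definition partite (V : finType) (m : nat) (E : {set {set V}}) : Prop :=
  exists P : 'I_m -> {set V},
    [/\ (\bigcup_(i < m) P i)%SET = [set: V]%SET,
        forall i j : 'I_m, i != j -> [disjoint P i & P j]
      & forall (e : {set V}) (i : 'I_m), e \in E -> #|e :&: P i| <= 1].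

(* The r-augmentation: the fresh vertices S are 'I_(r - k), added through a
   disjoint sum. It is only meaningful for k <= r. *)
Definition augmentation (V : finType) (k r : nat) (E : {set {set V}}) :
    {set {set V + 'I_(r - k)}} :=
  [set (inl @: e) :|: (inr @: [set: 'I_(r - k)]) | e : {set V} in E]%SET.

Definition contains_copy (V W : finType)
    (F : {set {set V}}) (G : {set {set W}}) : bool :=
  [exists f : {ffun V -> W},
    injectiveb f && [forall e in F, (f @: e)%SET \in G]].

(* If every r-uniform hypergraph on n vertices contains F (which is possible
   only when F has no edges), the maximum is over the empty family and is 0. *)
Definition turan_number (V : finType) (r n : nat) (F : {set {set V}}) : nat :=
  \max_(G : {set {set 'I_n}} | uniform r G && ~~ contains_copy F G) #|G|.

Local Open Scope classical_set_scope.
Local Open Scope ring_scope.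

Definition turan_density (R : realType) (V : finType) (r : nat)
    (F : {set {set V}}) : R :=
  lim (((turan_number r n F)%:R / 'C(n, r)%:R : R) @[n --> \oo]).

(* Main.v *)
Require Import Defs.
From mathcomp Require Import all_boot all_order all_algebra.
From mathcomp Require Import all_classical all_reals all_analysis.
From mathcomp Require Import zify.

(* If an r-uniform hypergraph G on n vertices has density at least
   (k+1)/(r+1), then an (r+1)-set T contains at least k+1 edges of G on average,
   so a positive proportion of the (r+1)-sets contain more than k edges.  The
   edges T - x_0, ..., T - x_k inside such a T form the augmentation, by
   S = T - {x_0, ..., x_k}, of the complete k-uniform hypergraph on the x_i.
   By pigeonhole some S occurs for c n^(k+1) choices of x, and Erdos's theorem
   on dense (k+1)-uniform hypergraphs then yields large sets A_0, ..., A_k all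
   of whose transversals occur with that S.  Embedding the i-th part of H in
   A_i gives a copy of H(r), so the Turan density is at most (k+1)/(r+1). *)

Import Order.TTheory GRing.Theory Num.Theory.
Import numFieldNormedType.Exports.

(** * Averaging, and Erdos's theorem for dense sets of tuples *)

Lemma exists_ge_average (I : finType) (P : pred I) (F : I -> nat) :
  0 < \sum_(i | P i) F i ->
  exists2 i, P i & \sum_(i | P i) F i <= #|P| * F i.
Proof.
case: (pickP P) => [i0 Pi0 _|P0]; last by rewrite big_pred0.
case: (arg_maxnP F Pi0) => i Pi maxF; exists i => //.
rewrite -sum_nat_const; exact: leq_sum.
Qed.

Lemma card_tupleS (T : finType) (s : nat) (Q : {set s.+1.-tuple T}) :
  #|Q| = \sum_w #|[set y : s.-tuple T | [tuple of w :: y] \in Q]|.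
Proof.
under eq_bigr do rewrite -sum1_card.
rewrite pair_big_dep /= -sum1_card.
rewrite (reindex (fun p : T * s.-tuple T => [tuple of p.1 :: p.2])) /=.
  by apply: eq_bigl => -[w y] /=; rewrite inE.
exists (fun x => (thead x, [tuple of behead x])) => [[w y] _|x _] /=.
  by congr pair; apply/val_inj.
by rewrite -tuple_eta.
Qed.

Lemma subset_of_card (T : finType) (A : {set T}) (m : nat) :
  m <= #|A| -> exists2 B : {set T}, B \subset A & #|B| = m.
Proof.
move=> mA; have := bin_gt0 #|A| m; rewrite mA -cards_draws card_gt0.
by case/set0Pn => B; rewrite inE => /andP[sBA /eqP]; exists B.
Qed.

(** Induction on [s]. Inside a bounded set [B] of first coordinates of large degree, double counting
    gives a positive proportion of tails [y] with at least [t] neighbours. By pigeonhole some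
    [t]-subset [A] of [B] is joined to a positive proportion of all tails; it serves as the first
    set, and the induction hypothesis applied to these tails supplies the others. *)
Lemma dense_contains_complete_partite (s t q : nat) :
  exists n0, forall (W : finType) (Q : {set s.-tuple W}),
    n0 <= #|W| -> #|W| ^ s <= q * #|Q| ->
    exists A : s.-tuple {set W}, (forall i, #|tnth A i| = t) /\
      forall x : s.-tuple W,
        (forall i, tnth x i \in tnth A i) -> x \in Q.
Proof.
elim: s q => [|s IHs] q.
  exists 0 => W Q _; rewrite expn0 muln_gt0 card_gt0 => /andP[_ /set0Pn[x xQ]].
  by exists [tuple]; split=> [[]|y _] //; rewrite [y]tuple0 -[[tuple]](tuple0 x).
(* With this [m], tails with at most [t] neighbours in [B] account for at most half of the
   guaranteed [m * n ^ s / (2 * q)] incidences; the successor keeps [m] positive when [t = 0]. The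
   new density parameter pays [4 * q] for richness and [2 ^ m] for the pigeonhole. *)
pose m := 4 * q * t.+1; have [n1 IH] := IHs (4 * q * 2 ^ m).
(* At least [n / (2 * q)] vertices turn out heavy, so the first term provides [m] of them; [n1]
   serves the induction hypothesis, and [1] makes [W] nonempty. *)
exists (2 * q * m + n1 + 1) => W Q.
set n := #|W| => n_ge dQ.
pose nbr (y : s.-tuple W) := [set w | [tuple of w :: y] \in Q].
pose deg w := #|[set y : s.-tuple W | [tuple of w :: y] \in Q]|.
have degE : #|Q| = \sum_w deg w by rewrite card_tupleS.
have n_gt0 : 0 < n by lia.
have ns_gt0 : 0 < n ^ s by rewrite expn_gt0 n_gt0.
have q_gt0 : 0 < q by case: (posnP q) dQ => // ->; rewrite expnS; nia.
have card_tup : #|{: s.-tuple W}| = n ^ s by rewrite card_tuple.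
pose heavy := [set w | n ^ s <= 2 * q * deg w].
have heavy_large : m <= #|heavy|.
  (* Light vertices contribute at most [n * n ^ s], half of the lower bound for [2 * q * #|Q|];
     heavy ones have degree at most [n ^ s]. *)
  have : 2 * q * #|Q| <= n * n ^ s + #|heavy| * (2 * q * n ^ s).
    rewrite degE big_distrr /= (bigID (mem heavy)) /= addnC leq_add //.
      have -> : n * n ^ s = \sum_(w : W) n ^ s by rewrite sum_nat_const.
      rewrite [leqRHS](bigID (mem heavy)) /=.
      apply: leq_trans (leq_addl _ _); apply: leq_sum => w; rewrite inE; lia.
    rewrite -sum_nat_const; apply: leq_sum => w _.
    by rewrite leq_mul2l -card_tup max_card orbT.
  rewrite expnS in dQ => dQ2.
  have : n * n ^ s <= 2 * q * #|heavy| * n ^ s by nia.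
  by rewrite leq_pmul2r //; nia.
have [B sBH cB] := subset_of_card _ _ _ heavy_large.
pose rich := [set y : s.-tuple W | t <= #|nbr y :&: B|].
have degB : \sum_(w in B) deg w = \sum_y #|nbr y :&: B|.
  rewrite (eq_bigr (fun w => \sum_(y : s.-tuple W) ([tuple of w :: y] \in Q))).
    rewrite exchange_big /=; apply: eq_bigr => y _.
    rewrite -sum1_card -big_mkcondr /=; apply: eq_big => // w.
    by rewrite !inE andbC.
  move=> w _; rewrite /deg -sum1_card big_mkcond /=.
  by apply: eq_bigr => y _; rewrite inE; case: ifP.
have rich_large : n ^ s <= 4 * q * #|rich|.
  have lb : m * n ^ s <= 2 * q * \sum_(w in B) deg w.
    rewrite -cB -sum_nat_const big_distrr /=; apply: leq_sum => w wB.
    by have := fintype.subsetP sBH w wB; rewrite inE.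
  have ub : \sum_(w in B) deg w <= n ^ s * t + #|rich| * m.
    rewrite degB (bigID (mem rich)) /= addnC leq_add //.
      have -> : n ^ s * t = \sum_(y : s.-tuple W) t.
        by rewrite sum_nat_const card_tuple.
      rewrite [leqRHS](bigID (mem rich)) /=.
      apply: leq_trans (leq_addl _ _); apply: leq_sum => y; rewrite inE; lia.
    rewrite -sum_nat_const; apply: leq_sum => y _.
    by rewrite -cB subset_leq_card // finset.subsetIr.
  have : m * n ^ s <= 2 * q * (n ^ s * t + #|rich| * m).
    by apply: leq_trans lb _; rewrite leq_mul2l ub orbT.
  have m_gt0 : 0 < m by rewrite /m; nia.
  have : 2 * (2 * q * (n ^ s * t)) <= m * n ^ s by rewrite /m; nia.
  move=> h1 h2.
  have : m * n ^ s <= m * (4 * q * #|rich|) by nia.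
  by rewrite leq_pmul2l.
(* Pigeonhole over the at most [2 ^ m] candidates [A] inside the bounded set
   [B] costs a factor independent of [n]. *)
pose common (A : {set W}) := [set y : s.-tuple W | A \subset nbr y].
pose small := [pred A : {set W} | (A \subset B) && (#|A| == t)].
have rich_sum : #|rich| <= \sum_(A | small A) #|common A|.
  rewrite (eq_bigr (fun A : {set W} =>
    \sum_(y : s.-tuple W) (A \subset nbr y))); last first.
    move=> A _; rewrite -sum1_card big_mkcond /=.
    by apply: eq_bigr => y _; rewrite inE; case: ifP.
  rewrite exchange_big /= -sum1_card big_mkcond /=; apply: leq_sum => y _.
  case: ifP => //; rewrite inE => /subset_of_card[A].
  rewrite finset.subsetI => /andP[sAN sAB] /eqP cA.
  by rewrite (bigD1 A) /= ?sAN // sAB.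
have rich_gt0 : 0 < #|rich| by nia.
have [A /andP[sAB /eqP cA] cAr] :=
  exists_ge_average _ _ _ (leq_trans rich_gt0 rich_sum).
have small_le : #|small| <= 2 ^ m.
  rewrite -cB -card_powerset; apply: subset_leq_card; apply/fintype.subsetP => C.
  by rewrite !inE => /andP[].
have [||A' [cA' A'P]] := IH W (common A).
- lia.
- apply: leq_trans rich_large _; rewrite -[leqRHS]mulnA leq_mul2l.
  apply/orP; right; apply: leq_trans rich_sum _; apply: leq_trans cAr _.
  by rewrite leq_mul2r small_le orbT.
exists [tuple of A :: A']; split=> [i|x xA].
  by case: (unliftP ord0 i) => [j|] ->; rewrite ?tnthS ?tnth0.
rewrite (tuple_eta x).
have : [tuple of behead x] \in common A.
  apply: A'P => i; have := xA (lift ord0 i); rewrite tnthS.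
  by rewrite {1}(tuple_eta x) tnthS.
rewrite inE => /fintype.subsetP/(_ (thead x)); rewrite inE; apply.
by have := xA ord0; rewrite tnth0.
Qed.

(** * From a dense uniform hypergraph to a set with many cliques in its link *)

Lemma leq_expn_ffact (n m : nat) : 2 * m <= n -> n ^ m <= 2 ^ m * n ^_ m.
Proof.
move=> mn; rewrite ffact_prod -[m in n ^ m]card_ord -[m in 2 ^ m]card_ord.
rewrite -!prod_nat_const -big_split /=.
by apply: leq_prod => i _; have := ltn_ord i; lia.
Qed.

Lemma leq_bin_expn (n m : nat) : 'C(n, m) <= n ^ m.
Proof.
apply: (@leq_trans (n ^_ m)).
  by rewrite -bin_ffact leq_pmulr // fact_gt0.
rewrite ffact_prod -[m in n ^ m]card_ord -prod_nat_const.
by apply: leq_prod => i _; apply: leq_subr.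
Qed.

(** When [#|S| = r - k], these are the ordered cliques on [k.+1] vertices in the usual [k]-uniform
    link of [S]. They are kept as tuples so that the theorem on dense sets of tuples applies
    directly. *)
Definition link (W : finType) (k : nat) (G : {set {set W}}) (S : {set W}) :
    {set k.+1.-tuple W} :=
  [set x : k.+1.-tuple W | [&& uniq x, [disjoint S & x]
    & [forall i, S :|: ([set w in x] :\ tnth x i) \in G]]].

(** No size is imposed on [T]: if [G] is [r]-uniform, a single deletion landing in [G] forces
    [#|T| = r.+1]. *)
Definition rich_sets (W : finType) (k : nat) (G : {set {set W}}) :
    {set {set W}} :=
  [set T : {set W} | k < #|[set v in T | T :\ v \in G]|].

Lemma card_edge (W : finType) (r : nat) (G : {set {set W}}) (e : {set W}) :
  uniform r G -> e \in G -> #|e| = r.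
Proof. by move=> Gunif eG; have /forall_inP/(_ e eG)/eqP := Gunif. Qed.

Lemma sum_card_nonincident (W : finType) (r : nat) (G : {set {set W}}) :
  uniform r G ->
  \sum_(v : W) #|[set e in G | v \notin e]| = #|G| * (#|W| - r).
Proof.
move=> Gunif.
rewrite (eq_bigr (fun v : W => \sum_(e in G) (v \notin e : nat))).
  rewrite exchange_big /= -sum_nat_const; apply: eq_bigr => e eG.
  rewrite -(card_edge _ _ _ _ Gunif eG) -cardsT -cardsDS ?finset.subsetT //.
  rewrite -sum1_card [RHS]big_mkcond; apply: eq_bigr => v _.
  by rewrite !inE andbT; case: (v \in e).
move=> v _; rewrite -sum1_card big_mkcond [RHS]big_mkcond /=.
by apply: eq_bigr => e _; rewrite inE; case: (e \in G); case: (v \in e).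
Qed.

(** The map sending [(T, v)] to [(T :\ v, v)] is a bijection onto the pairs of an edge and a vertex
    outside it. *)
Lemma sum_card_codegree (W : finType) (r : nat) (G : {set {set W}}) :
  uniform r G ->
  \sum_(T : {set W}) #|[set v in T | T :\ v \in G]| = #|G| * (#|W| - r).
Proof.
move=> Gunif; transitivity (\sum_(v : W) #|[set e in G | v \notin e]|).
  rewrite (eq_bigr (fun T : {set W} => \sum_v ((v \in T) && (T :\ v \in G) : nat))).
    rewrite exchange_big /=; apply: eq_bigr => v _.
    rewrite -sum1_card -big_mkcondr /=.
    rewrite (reindex_onto (fun e => v |: e) (fun T => T :\ v)) /=; last first.
      by move=> T /andP[vT _]; rewrite finset.setD1K.
    apply: eq_bigl => e; rewrite !inE eqxx /=.
    case: (boolP (v \in e)) => ve; last by rewrite finset.setU1K // eqxx.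
    rewrite andbF; apply/negP => /andP[_ /eqP e_eq].
    by rewrite -e_eq !inE eqxx in ve.
  move=> T _; rewrite -sum1_card big_mkcond /=.
  by apply: eq_bigr => v _; rewrite inE; case: ifP.
exact: sum_card_nonincident.
Qed.

(** In the codegree sum a rich set counts at most [r.+1], any other [r.+1]-set at most [k], and sets
    of other sizes nothing. The density hypothesis makes the sum at least [k.+1] times the number of
    [r.+1]-sets. *)
Lemma rich_sets_large (W : finType) (k r : nat) (G : {set {set W}}) :
  uniform r G ->
  r < #|W| -> k.+1 * 'C(#|W|, r) <= r.+1 * #|G| ->
  'C(#|W|, r.+1) <= r.+1 * #|rich_sets W k G|.
Proof.
move=> Gunif rW dG; set N := 'C(_, _).
have ub : #|G| * (#|W| - r) <= N * k + #|rich_sets W k G| * r.+1.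
  rewrite -(sum_card_codegree _ _ _ Gunif).
  have szT (T : {set W}) v : v \in [set v in T | T :\ v \in G] -> #|T| = r.+1.
    rewrite inE => /andP[vT /(card_edge _ _ _ _ Gunif)].
    by rewrite (cardsD1 v T) vT => ->.
  rewrite (bigID (mem (rich_sets W k G))) /= addnC leq_add //.
    rewrite /N -card_draws -sum_nat_const [leqRHS]big_mkcond /= big_mkcond /=.
    apply: leq_sum => T _; rewrite !inE -leqNgt.
    case: ifP => // cT; case: ifP => // /eqP T_neq.
    by rewrite leqn0 cards_eq0; apply/eqP/finset.setP => v; rewrite [RHS]inE;
      apply/negP => /szT.
  rewrite -sum_nat_const; apply: leq_sum => T; rewrite inE => /ltn_predK.
  set A := [set _ in _ | _] => cA.
  have /card_gt0P[v vA] : 0 < #|A| by rewrite -cA.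
  rewrite -(szT _ _ vA); apply: subset_leq_card; apply/fintype.subsetP => w.
  by rewrite inE => /andP[].
have := mul_bin_left #|W| r; rewrite -/N => binE.
have : r.+1 * (k.+1 * N) <= r.+1 * (#|G| * (#|W| - r)) by nia.
by rewrite leq_pmul2l // => h; nia.
Qed.

(** The map sending [(S, x)] to the union of [S] and the entries of [x] reaches every rich [T]: let
    [x] enumerate [k.+1] vertices whose deletion from [T] gives an edge, and let [S] be the rest. *)
Lemma rich_sets_le_links (W : finType) (k r : nat) (G : {set {set W}}) :
  uniform r G ->
  k <= r -> #|rich_sets W k G| <=
    \sum_(S : {set W} | #|S| == r - k) #|link W k G S|.
Proof.
move=> Gunif kr.
pose P := [set p : {set W} * k.+1.-tuple W |
  (#|p.1| == r - k) && (p.2 \in link W k G p.1)].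
have -> : \sum_(S : {set W} | #|S| == r - k) #|link W k G S| = #|P|.
  under eq_bigr do rewrite -sum1_card.
  rewrite pair_big_dep /= -sum1_card; apply: eq_bigl => -[S x].
  by rewrite [RHS]inE.
apply: leq_trans (leq_imset_card (fun p : {set W} * k.+1.-tuple W =>
  p.1 :|: [set w in p.2]) P).
apply: subset_leq_card; apply/fintype.subsetP => T.
rewrite inE => /subset_of_card[X sX cX].
have XT : X \subset T.
  apply: fintype.subset_trans sX _; apply/fintype.subsetP => v.
  by rewrite inE => /andP[].
have szX : size (enum X) == k.+1 by rewrite -cardE cX.
apply/imsetP; exists (T :\: X, Tuple szX); last first.
  apply/finset.setP => v; rewrite !inE mem_enum.
  by case: (boolP (v \in X)) => [/(fintype.subsetP XT) ->|_] //=; rewrite orbF.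
have xE : [set w in Tuple szX] = X by apply/finset.setP => v; rewrite inE mem_enum.
have TD v : v \in X -> (T :\: X) :|: (X :\ v) = T :\ v.
  move=> vX; apply/finset.setP => w; rewrite !inE.
  case: (eqVneq w v) => [->|_] /=; first by rewrite vX.
  by case: (boolP (w \in X)) => [/(fintype.subsetP XT) ->|_] //=; rewrite orbF.
have TG v : v \in X -> T :\ v \in G.
  by move/(fintype.subsetP sX); rewrite inE => /andP[].
rewrite !inE /= enum_uniq /=; apply/and3P; split.
- have /card_gt0P[v vX] : 0 < #|X| by rewrite cX.
  have := card_edge _ _ _ _ Gunif (TG v vX); have := cardsD1 v T.
  by rewrite (fintype.subsetP XT v vX) (cardsDS XT) cX => *; apply/eqP; lia.
- rewrite disjoint_subset; apply/fintype.subsetP => v.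
  by rewrite !inE mem_enum => /andP[].
- apply/forallP => i; rewrite xE.
  have iX : tnth (Tuple szX) i \in X by rewrite -mem_enum; exact: mem_tnth.
  by rewrite TD // TG.
Qed.

Lemma exists_large_link (W : finType) (k r : nat) (G : {set {set W}}) :
  uniform r G ->
  k <= r -> 2 * r.+1 <= #|W| -> k.+1 * 'C(#|W|, r) <= r.+1 * #|G| ->
  exists2 S : {set W}, #|S| = r - k
    & #|W| ^ k.+1 <= 2 ^ r.+1 * (r.+1)`! * r.+1 * #|link W k G S|.
Proof.
move=> Gunif kr rW dG; set n := #|W|.
have rich_large := rich_sets_large _ k _ _ Gunif ltac:(lia) dG.
rewrite -/n in rich_large.
have N_gt0 : 0 < 'C(n, r.+1) by rewrite bin_gt0; lia.
have rich_gt0 : 0 < #|rich_sets W k G| by nia.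
have [S /eqP cS] := exists_ge_average _ _ _
  (leq_trans rich_gt0 (rich_sets_le_links _ _ _ _ Gunif kr)).
move=> /(leq_trans (rich_sets_le_links _ _ _ _ Gunif kr)) leS; exists S => //.
have cP : #|(fun S : {set W} => #|S| == r - k)| <= n ^ (r - k).
  apply: leq_trans (leq_bin_expn n (r - k)); rewrite -card_draws.
  by apply: subset_leq_card; apply/fintype.subsetP => A; rewrite inE.
(* Since [n ^ (r - k)] bounds the number of candidates [S], multiplying by it reduces the claim to
   comparing [n ^ r.+1] with the number of rich sets. *)
rewrite -(@leq_pmul2l (n ^ (r - k))) ?expn_gt0; last by lia.
rewrite -expnD; have -> : r - k + k.+1 = r.+1 by lia.
apply: leq_trans (leq_expn_ffact _ _ rW) _; rewrite -bin_ffact -/n.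
have : #|rich_sets W k G| <= n ^ (r - k) * #|link W k G S|.
  by apply: leq_trans leS _; rewrite leq_mul2r cP orbT.
move=> le1; have le2 : 'C(n, r.+1) <= r.+1 * (n ^ (r - k) * #|link W k G S|).
  by apply: leq_trans rich_large _; rewrite leq_mul2l le1 orbT.
have -> : n ^ (r - k) * (2 ^ r.+1 * (r.+1)`! * r.+1 * #|link W k G S|) =
  2 ^ r.+1 * (r.+1 * (n ^ (r - k) * #|link W k G S|) * (r.+1)`!) by nia.
by rewrite leq_mul2l leq_mul2r le2 !orbT.
Qed.

(** * Embedding the augmentation *)

Lemma partite_coloring (V : finType) (m : nat) (E : {set {set V}}) :
  partite m.+1 E ->
  exists c : V -> 'I_m.+1, forall e, e \in E -> {in e &, injective c}.
Proof.
case=> P [covP _ edgeP].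
have /fin_all_exists[c cP] (v : V) : exists i, v \in P i.
  have : v \in (\bigcup_(i < m.+1) P i)%SET by rewrite covP inE.
  by case/finset.bigcupP => i _; exists i.
exists c => e eE v v' ve v'e cv.
apply: (card_le1_eqP (edgeP e (c v) eE)); first by rewrite inE v'e cv cP.
by rewrite inE ve cP.
Qed.

(** Vertices of colour [i] go into the [i]-th set and the fresh vertices onto [S]. An edge misses
    exactly one colour [j]; completing its image by a point of the [j]-th set gives a transversal in
    the link, and dropping that point leaves an edge of [G]. The successor in [#|V|.+1] keeps the
    sets nonempty even if [V] is empty. *)
Lemma complete_link_contains_augmentation (V W : finType) (k r : nat)
    (E : {set {set V}}) (G : {set {set W}}) (S : {set W})
    (A : k.+1.-tuple {set W}) :
  uniform k E -> partite k.+1 E -> #|S| = r - k ->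
  (forall i, #|tnth A i| = #|V|.+1) ->
  (forall x : k.+1.-tuple W, (forall i, tnth x i \in tnth A i) ->
     x \in link W k G S) ->
  contains_copy (augmentation k r E) G.
Proof.
move=> Eunif /partite_coloring[c c_inj] cS cA linkA.
have /fin_all_exists[a aA] (i : 'I_k.+1) : exists w, w \in tnth A i.
  by apply/card_gt0P; rewrite cA.
have AS i w : w \in tnth A i -> w \notin S.
  move=> wA; pose x := [tuple if j == i then w else a j | j < k.+1].
  have /linkA : forall j, tnth x j \in tnth A j.
    by move=> j; rewrite tnth_mktuple; case: eqP => // ->.
  rewrite inE => /and3P[_]; rewrite disjoint_sym disjoint_subset.
  move=> /fintype.subsetP/(_ w); rewrite !inE => /(_ _)-> //.
  by apply/tnthP; exists i; rewrite tnth_mktuple eqxx.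
have Adisj i j w : w \in tnth A i -> w \in tnth A j -> i = j.
  move=> wi wj; apply/eqP; apply: contraT => ij.
  (* A common point of two of the sets would give a transversal with a repeated entry, which the
     link excludes. *)
  pose x := [tuple if (l == i) || (l == j) then w else a l | l < k.+1].
  have /linkA : forall l, tnth x l \in tnth A l.
    move=> l; rewrite tnth_mktuple.
    by case: (eqVneq l i) => [->|_] //; case: (eqVneq l j) => [->|_] /=.
  rewrite inE => /and3P[/tuple_uniqP /(_ i j) + _ _].
  by rewrite !tnth_mktuple !eqxx orbT => /(_ erefl)/eqP; rewrite (negbTE ij).
(* Using the rank in all of [V] makes [phi] injective on each colour class; [rank_lt] ensures that
   the default of [nth] is never reached. *)
pose phi (v : V) := nth (a (c v)) (enum (tnth A (c v))) (enum_rank v).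
have rank_lt (v : V) : enum_rank v < size (enum (tnth A (c v))).
  by rewrite -cardE cA ltnS ltnW.
have phiA v : phi v \in tnth A (c v) by rewrite -mem_enum mem_nth.
have phi_inj : injective phi.
  move=> v v' e; have cvv' : c v = c v'.
    by apply: (Adisj _ _ (phi v)) => //; rewrite e.
  apply: enum_rank_inj; apply: val_inj; move/eqP: e.
  rewrite /phi (set_nth_default (a (c v))) ?rank_lt // cvv' nth_uniq ?enum_uniq //.
  - by move/eqP.
  - by rewrite -cvv'.
pose psi (j : 'I_(r - k)) := enum_val (cast_ord (esym cS) j).
have psiS j : psi j \in S by apply: enum_valP.
have psi_inj : injective psi by move=> j j' /enum_val_inj/cast_ord_inj.
have psi_im : psi @: [set: 'I_(r - k)]%SET = S.
  apply/eqP; rewrite eqEcard card_imset // cardsT card_ord cS leqnn andbT.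
  by apply/fintype.subsetP => w /imsetP[j _ ->].
pose f : {ffun V + 'I_(r - k) -> W} := [ffun z =>
  match z with inl v => phi v | inr j => psi j end].
apply/existsP; exists f; apply/andP; split.
  apply/injectiveP => -[v|j] [v'|j']; rewrite !ffunE.
  - by move/phi_inj => ->.
  - by move=> e; have := AS _ _ (phiA v); rewrite e psiS.
  - by move=> e; have := AS _ _ (phiA v'); rewrite -e psiS.
  - by move/psi_inj => ->.
apply/forall_inP => _ /imsetP[e eE ->].
have ce : #|e| = k by have /forall_inP/(_ e eE)/eqP := Eunif.
have -> : f @: ((inl @: e) :|: (inr @: [set: 'I_(r - k)])) = S :|: (phi @: e).
  rewrite imsetU -!imset_comp finset.setUC; congr (_ :|: _).
    by rewrite -[RHS]psi_im; apply: eq_imset => j; rewrite /= ffunE.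
  by apply: eq_imset => v; rewrite /= ffunE.
have card_ce : #|c @: e| = k by rewrite card_in_imset //; apply: c_inj.
have : 0 < #|~: (c @: e)|.
  by have := cardsC (c @: e); rewrite card_ord; lia.
case/card_gt0P => j; rewrite inE => jce.
have ce_full i : i != j -> i \in c @: e.
  move=> ij; apply: contraT => ice.
  have : #|c @: e| <= #|~: [set i; j]|.
    apply: subset_leq_card; apply/fintype.subsetP => l lce; rewrite !inE.
    by apply/norP; split; apply: contraTneq lce => ->.
  have := cardsC [set i; j]; rewrite card_ord cards2 ij card_ce; lia.
(* Only the missing colour [j] falls back on the default point [a j]. *)
pose x := [tuple oapp phi (a i) [pick v in e | c v == i] | i < k.+1].
have xe v : v \in e -> tnth x (c v) = phi v.
  move=> ve; rewrite tnth_mktuple; case: pickP => [v' /andP[v'e /eqP cv]|/(_ v)] /=.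
    by congr phi; apply: (c_inj _ eE).
  by rewrite ve eqxx.
have /linkA : forall i, tnth x i \in tnth A i.
  move=> i; rewrite tnth_mktuple; case: pickP => //= v /andP[_ /eqP <-].
  exact: phiA.
rewrite inE => /and3P[/tuple_uniqP x_inj _ /forallP/(_ j)].
have -> // : [set w in x] :\ tnth x j = phi @: e.
apply/finset.setP => w; rewrite !inE; apply/andP/imsetP => [[wj /tnthP[i wi]]|[v ve ->]].
  have /ce_full/imsetP[v ve iv] : i != j by apply: contraNneq wj => <-; rewrite wi.
  by exists v; rewrite // wi iv xe.
rewrite -xe //; split; last exact: mem_tnth.
by apply: contraNneq jce => /x_inj <-; apply: imset_f.
Qed.

(** * Bounds on Turan numbers *)

(** Averaging over vertex deletions: each edge of an extremal hypergraph on [n.+1] vertices survives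
    [n.+1 - r] of them, and each deletion leaves an [F]-free hypergraph, relabelled on ['I_n]
    through [lift v]. *)
Lemma turan_number_deletion (V : finType) (F : {set {set V}}) (r n : nat) :
  r <= n -> turan_number r n.+1 F * (n.+1 - r) <= n.+1 * turan_number r n F.
Proof.
(* Integer division isolates the maximum, which can then be bounded one hypergraph at a time. *)
move=> rn; rewrite -leq_divRL ?subn_gt0 ?ltnS //.
apply/bigmax_leqP => G /andP[Gunif Gfree]; rewrite leq_divRL ?subn_gt0 ?ltnS //.
have := sum_card_nonincident _ _ _ Gunif; rewrite card_ord => <-.
have -> : n.+1 * turan_number r n F = \sum_(v < n.+1) turan_number r n F.
  by rewrite sum_nat_const card_ord.
apply: leq_sum => v _.
pose Gv := [set e : {set 'I_n} | lift v @: e \in G].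
have lift_injv : injective (lift v) by apply: lift_inj.
have le1 : #|[set e in G | v \notin e]| <= #|Gv|.
  apply: leq_trans (leq_imset_card (fun e : {set 'I_n} => lift v @: e) Gv).
  apply: subset_leq_card; apply/fintype.subsetP => e; rewrite inE => /andP[eG ve].
  have eE : e = lift v @: (lift v @^-1: e).
    apply/finset.setP => w; apply/idP/imsetP => [we|[i + ->]]; last by rewrite inE.
    case: (unliftP v w) => [i wi|wv]; last by rewrite -wv we in ve.
    by exists i; rewrite // inE -wi.
  by apply/imsetP; exists (lift v @^-1: e); rewrite // inE -eE.
apply: leq_trans le1 _.
rewrite /turan_number.
apply: (@leq_bigmax_cond _ _ (fun G : {set {set 'I_n}} => #|G|)).
apply/andP; split.
  apply/forall_inP => e; rewrite inE => eG.
  by have /forall_inP/(_ _ eG) := Gunif; rewrite card_imset.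
apply: contra Gfree => /existsP[f /andP[/injectiveP f_inj /forall_inP fG]].
apply/existsP; exists [ffun x => lift v (f x)]; apply/andP; split.
  by apply/injectiveP => x y; rewrite !ffunE => /lift_injv/f_inj.
apply/forall_inP => e /fG; rewrite inE -imset_comp => fGe.
by rewrite (eq_imset (g := lift v \o f)) // => x; rewrite ffunE.
Qed.

Lemma turan_number_augmentation_le (k r : nat) (V : finType) (E : {set {set V}}) :
  uniform k E -> partite k.+1 E -> k <= r ->
  exists n0, forall n, n0 <= n ->
    r.+1 * turan_number r n (augmentation k r E) <= k.+1 * 'C(n, r).
Proof.
move=> Eunif Epart kr.
have [n1 n1P] := dense_contains_complete_partite k.+1 #|V|.+1
  (2 ^ r.+1 * (r.+1)`! * r.+1).
exists (n1 + 2 * r.+1) => n n_ge.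
rewrite mulnC -leq_divRL //; apply/bigmax_leqP => G /andP[Gunif].
rewrite leq_divRL //; apply: contraR; rewrite -ltnNge => /ltnW dG.
have [||S cS link_large] := exists_large_link _ _ _ _ Gunif kr.
- by rewrite card_ord; lia.
- by rewrite card_ord [_ * #|_|]mulnC.
have [|A [cA linkA]] := n1P _ _ _ link_large; first by rewrite card_ord; lia.
exact: (complete_link_contains_augmentation _ _ _ _ _ _ S A).
Qed.

(** * Passage to the limit *)

Local Open Scope classical_set_scope.
Local Open Scope ring_scope.

Lemma turan_ratio_nonincreasing (R : realType) (V : finType)
    (F : {set {set V}}) (r n m : nat) : (r <= n)%N -> (n <= m)%N ->
  (turan_number r m F)%:R / 'C(m, r)%:R <=
    (turan_number r n F)%:R / 'C(n, r)%:R :> R.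
Proof.
move=> rn; elim: m => [|m IHm]; first by rewrite leqn0 => /eqP->.
rewrite leq_eqVlt ltnS => /predU1P[->//|nm]; apply: le_trans (IHm nm).
have rm : (r <= m)%N by apply: leq_trans nm.
rewrite ler_pdivrMr ?ltr0n ?bin_gt0 ?(leqW rm) // mulrAC.
rewrite ler_pdivlMr ?ltr0n ?bin_gt0 // -!natrM ler_nat.
have := turan_number_deletion V F r m rm.
have := mul_bin_down m.+1 r; rewrite succnK => binE ex_le.
rewrite -(@leq_pmul2l m.+1) // mulnCA binE !mulnA.
by rewrite leq_mul2r ex_le orbT.
Qed.

(** The ratio is nonnegative and nonincreasing from [n = r] on; for [n < r] the denominator vanishes
    and the ratio is 0 by convention, so monotonicity is only eventual. *)
Lemma is_cvg_turan_ratio (R : realType) (V : finType) (F : {set {set V}}) (r : nat) :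
  cvg (((turan_number r n F)%:R / 'C(n, r)%:R : R) @[n --> \oo]).
Proof.
apply: (@near_nonincreasing_is_cvgn _ _ 0).
  near=> n => m nm; apply: turan_ratio_nonincreasing => //.
  by near: n; exact: nbhs_infty_ge.
by apply: nearW => n; rewrite divr_ge0.
Unshelve. all: by end_near. Qed.

Lemma turan_density_ge0 (R : realType) (V : finType) (F : {set {set V}}) (r : nat) :
  0 <= turan_density R r F.
Proof.
apply: limr_ge; first exact: is_cvg_turan_ratio.
by apply: nearW => n; rewrite divr_ge0.
Qed.

Lemma turan_density_augmentation_le (R : realType) (k r : nat) (V : finType)
    (E : {set {set V}}) :
  uniform k E -> partite k.+1 E -> (k <= r)%N ->
  turan_density R r (augmentation k r E) <= k.+1%:R * harmonic r.
Proof.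
move=> Eunif Epart kr; apply: limr_le; first exact: is_cvg_turan_ratio.
have [n0 n0P] := turan_number_augmentation_le _ _ _ _ Eunif Epart kr.
near=> n; rewrite /harmonic /=.
rewrite ler_pdivrMr; last first.
  by rewrite ltr0n bin_gt0; near: n; exact: nbhs_infty_ge.
rewrite mulrAC ler_pdivlMr ?ltr0n // -!natrM ler_nat mulnC.
by apply: n0P; near: n; exact: nbhs_infty_ge.
Unshelve. all: by end_near. Qed.

Theorem proposition1p5 (R : realType) (k : nat) (V : finType)
    (E : {set {set V}}) (hk : (0 < k)%N) (hunif : uniform k E)
    (hpart : partite k.+1 E) :
  turan_density R r (augmentation k r E) @[r --> \oo] --> (0 : R).
Proof.
(* As [harmonic r] is [1 / (r + 1)], the upper bound is [(k + 1) / (r + 1)], valid once [k <= r]. *)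
apply: (@squeeze_cvgr _ _ _ _ (fun=> 0) (fun r => k.+1%:R * harmonic r)).
- near=> r; rewrite turan_density_ge0 turan_density_augmentation_le //.
  by near: r; exact: nbhs_infty_ge.
- exact: cvg_cst.
- rewrite -(mulr0 k.+1%:R); apply: cvgMl_tmp; exact: cvg_harmonic.
Unshelve. all: by end_near. Qed.
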